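(* If there exists a mixed Steiner system $\mathrm{MS}(2,3,\mathbb{Z}_2^n\times\mathbb{Z}_q)$, then $n\ge q$, and moreover either $6$ divides $n$ and $q$ is even, or $n\equiv q\equiv 2\pmod 6$, or $n\equiv q\equiv 4\pmod 6$.
   Context: For integers $q_1,\dots,q_N\ge 2$, $Q=\mathbb{Z}_{q_1}\times\cdots\times\mathbb{Z}_{q_N}$ is viewed as the set of words of length $N$ whose $i$-th letter lies in $\mathbb{Z}_{q_i}$; $\mathbb{Z}_2^n\times\mathbb{Z}_q$ has $n\ge1$ binary coordinates and one coordinate over $\mathbb{Z}_q$, $q\ge 2$. The weight of a word is its number of nonzero coordinates, and $d(\cdot,\cdot)$ is the Hamming distance. For integers $1\le t\le k\le N$, a mixed Steiner system $\mathrm{MS}(t,k,Q)$ is a set $\mathcal{C}$ of words of $Q$ of weight $k$ such that (i) for every word $x\in Q$ of weight $t$ there is exactly one $c\in\mathcal{C}$ with $d(x,c)=k-t$; and (ii) any two distinct elements of $\mathcal{C}$ are at Hamming distance at least $2(k-t)+1$. *)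

(* Defs.v *)
From HB Require Import structures.
From mathcomp Require Import all_boot all_algebra.

Set Implicit Arguments.
Unset Strict Implicit.
Unset Printing Implicit Defensive.

(* Z_(q 0) x ... x Z_(q (N-1)).  Meant for moduli at least 2: 'Z_0 and 'Z_1
   both denote Z_2. *)
Definition word (N : nat) (q : 'I_N -> nat) : Type :=
  {dffun forall i : 'I_N, 'Z_(q i)}.
HB.instance Definition _ N (q : 'I_N -> nat) := Finite.on (word q).

Definition weight (N : nat) (q : 'I_N -> nat) (x : word q) : nat :=
  #|[set i | x i != 0%R]|.

Definition hdist (N : nat) (q : 'I_N -> nat) (x y : word q) : nat :=
  #|[set i | x i != y i]|.

Definition mixed_steiner (N : nat) (q : 'I_N -> nat) (t k : nat)
    (C : {set word q}) : Prop :=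
  [/\ 1 <= t <= k /\ k <= N,
      forall c, c \in C -> weight c = k,
      forall x : word q, weight x = t ->
        exists! c, c \in C /\ hdist x c = k - t &
      forall c c', c \in C -> c' \in C -> c <> c' ->
        2 * (k - t) + 1 <= hdist c c'].

(* Moduli of Z_2^n x Z_q, the coordinate over Z_q being the last one. *)
Definition binary_plus (n q : nat) (i : 'I_n.+1) : nat :=
  if i < n then 2 else q.
Arguments binary_plus n q i : clear implicits.

(* Main.v *)
Require Import Defs.
From mathcomp Require Import all_boot all_algebra.
From mathcomp Require Import zify.

(** Double counting.  Write [A] for the codewords whose [Z_q] letter is zero and
    [B] for the others; they have three, respectively two, binary ones.  Fix a
    binary coordinate [i].  Every other binary coordinate, and every nonzero
    letter of [Z_q], lies with [i] in exactly one codeword; hence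
    [n - 1 = 2 A_i + B_i] and [q - 1 = B_i], so [n = q + 2 A_i].  Summing over
    [i] gives [n (n - q) = 6 |A|].  Finally, the codewords with a given nonzero
    letter form a perfect matching of the binary coordinates, so [n] is even. *)

(** The words differ at every point of [Y :\: X], where [X] and [Y] are the supports of [x] and [c],
    and this set has at least [k - t] elements. Distance [k - t] thus leaves no room for a
    disagreement on [X]. *)
Lemma hdist_cover (N : nat) (q : 'I_N -> nat) (t k : nat) (x c : word q) :
  weight x = t -> weight c = k -> t <= k ->
  hdist x c = k - t <-> forall i, x i != 0%R -> c i = x i.
Proof.
rewrite /weight /hdist; set X := [set i | x i != 0%R].
set Y := [set i | c i != 0%R]; set D := [set i | x i != c i].
move=> <- <- leXY; split=> [cardD i xi|xc].
- have sYD : Y :\: X \subset D.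
    apply/subsetP=> j; rewrite !inE negbK => /andP[/eqP-> cj].
    by rewrite eq_sym.
  have /eqP eqYD : Y :\: X == D.
    rewrite eqEcard sYD cardD cardsD leq_sub2l //.
    by apply: subset_leq_card; apply: subsetIr.
  have: i \notin D by rewrite -eqYD !inE xi.
  by rewrite inE negbK => /eqP.
- have sXY : X \subset Y.
    by apply/subsetP=> i; rewrite !inE => xi; rewrite xc.
  have -> : D = Y :\: X.
    apply/setP=> i; rewrite !inE negbK.
    by case: (eqVneq (x i) 0%R) => [->|/xc->]; rewrite ?eqxx // eq_sym.
  by rewrite cardsD (setIidPr sXY).
Qed.

(** Covering axiom in counting form, obtained from the weight-2 word [x] with letters [u] at [i] and
    [v] at [j]. *)
Lemma steiner2_pair (N : nat) (q : 'I_N -> nat) (k : nat) (C : {set word q})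
    (i j : 'I_N) (u : 'Z_(q i)) (v : 'Z_(q j)) :
  mixed_steiner 2 k C -> i != j -> u != 0%R -> v != 0%R ->
  \sum_(c in C) (c i == u) * (c j == v) = 1.
Proof.
case=> [[/andP[_ le2k] _] wC coverC _] neij u0 v0.
pose x : word q :=
  finfun (dfwith (dfwith (fun h => 0%R : 'Z_(q h)) u) v).
have xj : x j = v by rewrite ffunE dfwith_in.
have xi : x i = u by rewrite ffunE dfwith_out 1?eq_sym // dfwith_in.
have xo h : h != i -> h != j -> x h = 0%R.
  by move=> hi hj; rewrite ffunE !dfwith_out // eq_sym.
have wx : weight x = 2.
  rewrite /weight -[RHS](_ : #|[set i; j]| = 2); last by rewrite cards2 neij.
  apply: eq_card => h; rewrite !inE.
  case: (eqVneq h i) => [->|hi]; first by rewrite xi.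
  case: (eqVneq h j) => [->|hj]; first by rewrite xj.
  by rewrite xo ?eqxx.
have xP c : c \in C -> hdist x c = k - 2 <-> (c i == u) && (c j == v).
  move=> cC; have := hdist_cover _ _ _ _ _ _ wx (wC c cC) le2k => ->.
  split=> [xc|/andP[/eqP ci /eqP cj] h].
    by rewrite -xi -xj !xc ?xi ?xj ?eqxx.
  case: (eqVneq h i) => [->|hi]; first by rewrite xi.
  case: (eqVneq h j) => [->|hj]; first by rewrite xj.
  by rewrite xo ?eqxx.
have [c0 [[c0C /(xP _ c0C)/andP[c0i c0j]] c0uniq]] := coverC x wx.
rewrite (bigD1 c0) //= c0i c0j big1 // => c /andP[cC cc0].
apply/eqP; rewrite mulnb eqb0; apply: contra cc0 => /(xP _ cC) xc.
by apply/eqP/esym/c0uniq.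
Qed.

(** The modulus is kept as a variable because [binary_plus n q i] equals 2 at a binary coordinate
    only propositionally. *)
Lemma Zp2_neq0 (m : nat) (x : 'Z_m) : m = 2 -> (x != 0%R) = (x == 1%R).
Proof. by move=> m2; subst m; case: x => [[|[|[]]]]. Qed.

Lemma card_Zp_neq0 (m : nat) :
  1 < m -> #|[pred a : 'Z_m | a != 0%R]| = m.-1.
Proof. by move=> m_gt1; rewrite (cardC1 0%R) card_ord Zp_cast. Qed.

Section BinaryPlus.

Variables (n q : nat) (C : {set word (binary_plus n q)}).
Hypotheses (hq : 2 <= q) (SC : mixed_steiner 2 3 C).

Let bin : 'I_n -> 'I_n.+1 := widen_ord (leqnSn n).
Let b (c : word (binary_plus n q)) (i : 'I_n) := c (bin i) != 0%R.
Let l (c : word (binary_plus n q)) := c ord_max.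

Let bE c i : b c i = (c (bin i) == 1%R).
Proof. by apply: Zp2_neq0; rewrite /binary_plus /= ltn_ord. Qed.

Let bin_inj i j : (bin i == bin j) = (i == j).
Proof. by []. Qed.

Let bin_max i : bin i != ord_max.
Proof. by rewrite -val_eqE /= neq_ltn ltn_ord. Qed.

Let weight_bin c : c \in C -> \sum_i b c i + (l c != 0%R) = 3.
Proof.
case: SC => _ wC _ _ cC; rewrite -(wC c cC) /weight -sum1_card.
rewrite (eq_bigl (fun i => c i != 0%R)) => [|i]; last by rewrite inE.
by rewrite [RHS]big_mkcond big_ord_recr.
Qed.

Let pair_bin i j : i != j -> \sum_(c in C) b c i * b c j = 1.
Proof.
move=> neij; under eq_bigr do rewrite !bE.
by apply: (steiner2_pair _ _ _ _ _ _ _ _ SC); rewrite ?bin_inj ?GRing.oner_eq0.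
Qed.

Let pair_last i a : a != 0%R -> \sum_(c in C) b c i * (l c == a) = 1.
Proof.
move=> a0; under eq_bigr do rewrite bE.
by apply: (steiner2_pair _ _ _ _ _ _ _ _ SC); rewrite ?bin_max ?GRing.oner_eq0.
Qed.

Let card_last : #|[pred a : 'Z_(binary_plus n q ord_max) | a != 0%R]| = q.-1.
Proof.
have max_q : binary_plus n q ord_max = q by rewrite /binary_plus /= ltnn.
by rewrite -[in RHS]max_q card_Zp_neq0 ?max_q.
Qed.

Let last_degree i : \sum_(c in C) b c i * (l c != 0%R) = q.-1.
Proof.
rewrite -card_last -sum1_card.
(* Split by the value [a] of the last letter: each of the [q.-1] nonzero values contributes 1 by
   [pair_last]. *)
rewrite (eq_bigr (fun c => \sum_(a | a != 0%R) b c i * (l c == a))) => [|c _].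
  by rewrite exchange_big; apply: eq_bigr => a; apply: pair_last.
rewrite -big_distrr; congr (_ * _) => /=.
case: (boolP (l c != 0%R)) => lc.
  rewrite (bigD1 (l c)) //= eqxx big1 // => a /andP[_].
  by rewrite eq_sym => /negPf->.
by rewrite big1 // => a; move: lc; rewrite negbK => /eqP->;
   rewrite eq_sym => /negPf->.
Qed.

Let binary_degree i : \sum_(c in C) b c i * \sum_(j | j != i) b c j = n.-1.
Proof.
under eq_bigr do rewrite big_distrr.
rewrite exchange_big /= (eq_bigr (fun=> 1)) => [|j ji].
  by rewrite sum1_card -[in RHS](card_ord n) -(cardC1 i).
by rewrite pair_bin // eq_sym.
Qed.

Lemma steiner_degree (i : 'I_n) :
  n = q + 2 * \sum_(c in C) b c i * (l c == 0%R).
Proof.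
(* By weight 3, a codeword through [i] has one further binary one if its last letter is nonzero, and
   two otherwise. *)
have: \sum_(c in C) b c i * \sum_(j | j != i) b c j =
      \sum_(c in C) b c i * (l c != 0%R)
      + 2 * \sum_(c in C) b c i * (l c == 0%R).
  rewrite big_distrr -big_split; apply: eq_bigr => c cC /=.
  have := weight_bin c cC; rewrite (bigD1 i) //=.
  by case: (b c i) => //; case: (l c == 0%R) => /=; lia.
rewrite binary_degree last_degree; have := ltn_ord i; lia.
Qed.

Lemma steiner_even : ~~ odd n.
Proof.
have [a a0] : exists a : 'Z_(binary_plus n q ord_max), a != 0%R.
  by exists 1%R; rewrite GRing.oner_eq0.
have -> : n = 2 * \sum_(c in C) (l c == a); last by rewrite oddM.
(* Count the incidences of binary coordinates with codewords of last letter [a]: one per coordinate,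
   two per codeword. *)
transitivity (\sum_(i < n) \sum_(c in C) b c i * (l c == a)).
  by under eq_bigr do rewrite pair_last //; rewrite sum1_card card_ord.
rewrite exchange_big big_distrr; apply: eq_bigr => c cC /=.
rewrite -big_distrl /=; case: eqP => [lc|]; last by rewrite !muln0.
by have := weight_bin c cC; rewrite lc a0 muln1 addn1 => -[->].
Qed.

Lemma steiner_triples : n * (n - q) = 6 * \sum_(c in C) (l c == 0%R).
Proof.
transitivity (\sum_(i < n) 2 * \sum_(c in C) b c i * (l c == 0%R)).
  (* Each summand is [n - q], whatever [i] is; below, each codeword with last letter zero is counted
     at its three binary ones. *)
  under eq_bigr => i _ do rewrite -[2 * _](addKn q) -steiner_degree.
  by rewrite sum_nat_const card_ord.
rewrite -big_distrr -[6]/(2 * 3) -mulnA; congr (_ * _) => /=.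
rewrite exchange_big big_distrr; apply: eq_bigr => c cC /=.
rewrite -big_distrl /=; case: eqP => [lc|]; last by rewrite !muln0.
by have := weight_bin c cC; rewrite lc eqxx muln1 addn0 => ->.
Qed.

End BinaryPlus.

Theorem theorem3 (n q : nat) (hn : 1 <= n) (hq : 2 <= q) :
  (exists C : {set word (binary_plus n q)}, mixed_steiner 2 3 C) ->
  q <= n /\
  [\/ 6 %| n /\ ~~ odd q,
      n = 2 %[mod 6] /\ q = 2 %[mod 6] |
      n = 4 %[mod 6] /\ q = 4 %[mod 6]].
Proof.
case=> C SC.
have n_even := steiner_even _ _ _ SC.
have degree := steiner_degree _ _ _ hq SC (Ordinal hn).
have triples := steiner_triples _ _ _ hq SC.
have dvd3 : (3 %| n) || (3 %| n - q).
  by rewrite -Euclid_dvdM // triples dvdn_mulr.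
move: degree; set m := \sum_(c in C) _ => degree.
split; first lia.
(* [n] is even and [degree] gives [q] the same parity, so here 6 divides [n]. *)
have [n3|n3] := boolP (3 %| n); first by apply: Or31; lia.
(* Now [n] and [q] are even and congruent modulo 3, hence modulo 6, with common residue 2 or 4. *)
have {}dvd3 : 3 %| n - q by move: dvd3; rewrite (negPf n3).
have [n2|n2] := eqVneq (n %% 6) 2; first by apply: Or32; lia.
by apply: Or33; lia.
Qed.
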